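(* Let $X$ be a locally compact separable metric space, let $\widetilde X$ be its one-point compactification, and let $d$ be the metric on $X$ given by the restriction to $X$ of some metric $\widetilde d$ on $\widetilde X$. Let $f:X\to X$ be a proper map and let $\varphi\in C(X,\mathbb{R})$ be a function which can be continuously extended to a function $\widetilde\varphi$ on $\widetilde X$. Suppose $M(X,f)\neq\emptyset$. Then $$P_{X}(\varphi)\ \geq\ \sup\left\{h_\mu(f)+\int\varphi\, d\mu:\ \mu\in M(X,f)\right\}.$$
   Context: $M(X,f)$ denotes the set of all $f$-invariant Borel probability measures on $X$; $h_\mu(f)$ is the measure-theoretic entropy of $f$ with respect to $\mu$. A map $f:X\to X$ is proper if it is continuous and the pre-image of every compact set is compact. The one-point compactification $\widetilde X$ is the disjoint union $X\cup\{\infty\}$, whose open sets are the open sets of $X$ and the sets $A\cup\{\infty\}$ where the complement of $A$ in $X$ is compact; it is metrizable since $X$ is separable. An open set $U\subset X$ is admissible if its closure or its complement is compact. An admissible cover of $X$ is a finite cover $\mathcal{U}$ of $X$ by admissible open sets; $|\mathcal U|=\max\{\operatorname{diam} U:U\in\mathcal U\}$. Topological pressure. For an admissible cover $\mathcal U$, $\mathcal S_m(\mathcal U)$ is the set of strings $\mathbf U=(U_{i_0},\dots,U_{i_{m-1}})$ of elements of $\mathcal U$ of length $m=m(\mathbf U)$, $\mathcal S(\mathcal U)=\bigcup_{m\ge 0}\mathcal S_m(\mathcal U)$, and $X(\mathbf U)=\{x\in X: f^j(x)\in U_{i_j},\ j=0,\dots,m(\mathbf U)-1\}$. A collection of strings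 $\mathcal G$ covers $Z\subset X$ if $\bigcup_{\mathbf U\in\mathcal G}X(\mathbf U)\supset Z$. Put $(S_n\varphi)(x)=\sum_{k=0}^{n-1}\varphi(f^k(x))$. For $Z\subset X$ and $\alpha\in\mathbb R$ let $$M(Z,\alpha,\varphi,\mathcal U,N)=\inf_{\mathcal G}\sum_{\mathbf U\in\mathcal G}\exp\Big(-\alpha m(\mathbf U)+\sup_{x\in X(\mathbf U)}(S_{m(\mathbf U)}\varphi)(x)\Big),$$ the infimum over all finite or countable $\mathcal G\subset\mathcal S(\mathcal U)$ covering $Z$ with $m(\mathbf U)\ge N$ for all $\mathbf U\in\mathcal G$ (a supremum over the empty set is $-\infty$), and $m(Z,\alpha,\varphi,\mathcal U)=\lim_{N\to\infty}M(Z,\alpha,\varphi,\mathcal U,N)$. Define $$P_Z(\varphi,\mathcal U)=\inf\{\alpha: m(Z,\alpha,\varphi,\mathcal U)=0\}=\sup\{\alpha:m(Z,\alpha,\varphi,\mathcal U)=\infty\},\qquad P_Z(\varphi)=P_{Z,f}(\varphi)=\lim_{|\mathcal U|\to0}P_Z(\varphi,\mathcal U),$$ the limit being over admissible covers $\mathcal U$ of $X$ (which exist with arbitrarily small diameter for the metric $d$). *)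

(* Defs.v *)
From HB Require Import structures.
From mathcomp Require Import all_boot all_order all_algebra.
From mathcomp Require Import all_classical all_reals all_analysis.

Set Implicit Arguments.
Unset Strict Implicit.
Unset Printing Implicit Defensive.

Import Order.TTheory GRing.Theory Num.Theory.
Import numFieldNormedType.Exports.

Local Open Scope classical_set_scope.
Local Open Scope ring_scope.

(* Measurable types are pointed in the library, hence a space that carries Borel
   measures has to be pointed. A space with a probability measure is nonempty,
   so this costs no generality there. *)
#[short(type="pmetricType")]
HB.structure Definition PointedMetric (K : numDomainType) :=
  {T of Pointed T & Metric K T}.

Section topology.

Definition separable (T : topologicalType) : Prop :=
  exists D : set T, countable D /\ dense D.

Definition proper_map (T U : topologicalType) (f : T -> U) : Prop :=
  continuous f /\ forall K : set U, compact K -> compact (f @^-1` K).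

(* [d] is a metric on [T] that induces the given topology of [T]. Nonnegativity
   follows from the other axioms. *)
Definition metrizes (R : realType) (T : topologicalType) (d : T -> T -> R) :
    Prop :=
  [/\ forall x y, d x y = 0 <-> x = y,
      forall x y, d x y = d y x,
      forall x y z, d x z <= d x y + d y z &
      forall x, nbhs x =
        filter_from [set e : R | 0 < e] (fun e => [set y | d x y < e])].

End topology.

Section measures.
Context {R : realType}.

Definition borel (X : pmetricType R) := g_sigma_algebraType (@open X).

Definition invariant_measures (X : pmetricType R) (f : X -> X) :
    set (probability (borel X) R) :=
  [set mu | forall A : set (borel X), measurable A -> mu (f @^-1` A) = mu A].

Section entropy.
Context d (T : measurableType d).
Implicit Types (mu : probability T R) (f : T -> T).

(* [- x ln x], with value 0 at 0 since [ln 0 = 0]. *)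
Definition neg_xlnx (x : R) : R := - (x * ln x).

(* The atoms of the join of the [f^-j A], [j < n], are indexed by [s]; atoms that
   are empty contribute 0 to the entropy. *)
Definition join_atom f k (A : 'I_k -> set T) n (s : {ffun 'I_n -> 'I_k}) :
    set T :=
  [set x | forall j : 'I_n, A (s j) (iter j f x)].

Definition join_entropy mu f k (A : 'I_k -> set T) (n : nat) : R :=
  \sum_(s : {ffun 'I_n -> 'I_k}) neg_xlnx (fine (mu (join_atom f A s))).

Definition partition_entropy mu f k (A : 'I_k -> set T) : R :=
  limn (fun n => join_entropy mu f A n / n%:R).

Definition measure_entropy mu f : \bar R :=
  ereal_sup [set h | exists k (A : 'I_k -> set T),
    [/\ forall i, measurable (A i),
        partition [set: 'I_k] A [set: T] &
        h = (partition_entropy mu f A)%:E]].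

End entropy.
End measures.

Section pressure.
Context {R : realType} (X : pmetricType R).
(* [d] is not the metric of [X] but one that induces the same topology. *)
Context (d : X -> X -> R) (f : X -> X) (phi : X -> R).

Definition admissible (U : set X) : Prop :=
  open U /\ (compact (closure U) \/ compact (~` U)).

Definition admissible_cover (C : set (set X)) : Prop :=
  [/\ finite_set C, forall U, C U -> admissible U & \bigcup_(U in C) U = setT].

(* The added 0 only matters for the empty set, whose diameter is thus 0. *)
Definition diam (A : set X) : \bar R :=
  ereal_sup (0%E |` [set (d p.1 p.2)%:E | p in A `*` A]).

Definition cover_diam (C : set (set X)) : \bar R :=
  ereal_sup [set diam U | U in C].

Definition strings (C : set (set X)) : set (seq (set X)) :=
  [set s | forall U, U \in s -> C U].

Definition string_set (s : seq (set X)) : set X :=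
  [set x | forall j, (j < size s)%N -> nth set0 s j (iter j f x)].

Definition covers (G : set (seq (set X))) (Z : set X) : Prop :=
  Z `<=` \bigcup_(s in G) string_set s.

Definition birkhoff_sum (n : nat) (x : X) : R := \sum_(k < n) phi (iter k f x).

(* If [string_set s] is empty the supremum is [-oo] and the weight is 0. *)
Definition string_weight (a : R) (s : seq (set X)) : \bar R :=
  expeR ((- (a * (size s)%:R))%:E
    + ereal_sup [set (birkhoff_sum (size s) x)%:E | x in string_set s])%E.

Definition pressure_outer (Z : set X) (a : R) (C : set (set X)) (N : nat) :
    \bar R :=
  ereal_inf [set \esum_(s in G) string_weight a s | G in
    [set G | [/\ G `<=` strings C, countable G, covers G Z &
                 forall s, G s -> (N <= size s)%N]]].

Definition pressure_outer_lim (Z : set X) (a : R) (C : set (set X)) : \bar R :=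
  limn (pressure_outer Z a C).

Definition pressure_cover (Z : set X) (C : set (set X)) : \bar R :=
  ereal_inf [set a%:E | a in [set a : R | pressure_outer_lim Z a C = 0%E]].

Definition small_covers : set_system (set (set X)) :=
  filter_from [set e : R | 0 < e]
    (fun e => [set C | admissible_cover C /\ (cover_diam C < e%:E)%E]).

Definition pressure (Z : set X) : \bar R :=
  lim (pressure_cover Z C @[C --> small_covers]).

End pressure.

(* Main.v *)
Require Import Defs.
From HB Require Import structures.
From mathcomp Require Import all_boot all_order all_algebra.
From mathcomp Require Import all_classical all_reals all_analysis.
From mathcomp Require Import lra measurable_realfun.

(* Let [mu] be invariant, [A] a finite measurable partition into [k] sets, and
   let [G0] be a countable family of strings over a fine cover that covers [X],
   with weights [exp (- a m + sup S_m phi)] of sum less than 1/2. Up to small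
   measure finitely many strings of [G0] suffice, and up to small measure the
   element of the cover containing [x] determines the atom of [A] containing [x].
   Reading an orbit segment of length [n] as a concatenation of strings of [G0],
   with a blank letter of weight 1/2 at the rare times when none of the finitely
   many strings applies, and guessing the atom from the element of the cover,
   gives a subprobability [q] on [A]-names with
   [- ln (q (name of x)) <= sum_(j < n) (a - phi (f^j x) + error (f^j x)) + const].
   Integrating, Gibbs' inequality yields [H_n (A) <= n (a - int phi + small) +
   const]. Since [X] is invariant, concatenation needs no compactness, and since
   rare times are counted in the mean, no ergodic theorem is needed. *)

Set Implicit Arguments.
Unset Strict Implicit.
Unset Printing Implicit Defensive.

Import Order.TTheory GRing.Theory Num.Theory.
Import numFieldNormedType.Exports.

Local Open Scope classical_set_scope.
Local Open Scope ring_scope.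

(** * Subadditive sequences and code weights *)

Lemma subadditive_muln_le (R : realType) (u : nat -> R) (m q r : nat) :
  (forall m n, u (m + n)%N <= u m + u n) -> u (q * m + r)%N <= q%:R * u m + u r.
Proof.
move=> uD; elim: q => [|q IHq]; first by rewrite mul0n mul0r add0r add0n.
rewrite mulSn -addnA (le_trans (uD _ _))// -natr1 mulrDl mul1r.
by rewrite (addrC _ (u m)) -addrA lerD2l.
Qed.

(** The limit is the infimum of [u n / n] over [n >= 1]: Euclidean division of [n] by a nearly
    optimal index leaves a remainder whose cost is bounded independently of [n]. *)
Lemma fekete (R : realType) (u : nat -> R) : (forall n, 0 <= u n) ->
  (forall m n, u (m + n)%N <= u m + u n) -> cvgn (fun n => u n / n%:R).
Proof.
move=> u0 uD.
(* The index starts at 1 because [u 0 / 0] is 0 by convention and would spoil the infimum. *)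
pose S : set R := [set u n.+1 / n.+1%:R | n in [set: nat]].
have S0 : S !=set0 by exists (u 1%N / 1%:R), 0%N.
have Slb : has_lbound S.
  by exists 0 => _ [n _ <-]; rewrite divr_ge0.
apply/cvg_ex; exists (inf S); apply/cvgrPdist_le => e e0.
have [_ [m _ <-] hm] : exists2 y, S y & y < inf S + e / 2.
  by apply: inf_adherent => //; rewrite divr_gt0.
pose B := \sum_(r < m.+1) u r.
have BP r : (r < m.+1)%N -> u r <= B.
  move=> rm; rewrite /B (bigD1 (Ordinal rm))//= lerDl sumr_ge0//.
near=> n.
have n0 : (0 < n)%N by near: n; exists 1%N.
have n0' : 0 < n%:R :> R by rewrite ltr0n.
have lb : inf S <= u n / n%:R.
  by apply: ge_inf => //; exists n.-1 => //; rewrite prednK.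
rewrite ler_distlC; apply/andP; split; first by rewrite lerBlDr (le_trans lb)// lerDl ltW.
have h1 : u n <= (n %/ m.+1)%:R * u m.+1 + B.
  rewrite {1}(divn_eq n m.+1) (le_trans (subadditive_muln_le _ _ _ uD))// lerD2l.
  by rewrite BP// ltn_pmod.
have h2 : (n %/ m.+1)%:R * u m.+1 <= n%:R * (u m.+1 / m.+1%:R).
  rewrite mulrCA mulrC ler_wpM2l// ler_pdivlMr ?ltr0n//.
  by rewrite -natrM ler_nat leq_divM.
have h3 : B <= n%:R * (e / 2).
  rewrite -ler_pdivrMr ?divr_gt0//.
  near: n; apply: nbhs_infty_ger.
rewrite ler_pdivrMr// mulrC.
apply: (le_trans h1); apply: (le_trans (lerD h2 h3)).
rewrite -mulrDr ler_pM2l//; apply: (le_trans (lerD (ltW hm) (lexx _))).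
by rewrite -addrA -splitr.
Unshelve. all: by end_near. Qed.

(** Splits off the first letter, so that induction on the length follows the recursion of
    [code_weight]. *)
Lemma sum_ffun_ordS (R : nmodType) (I : finType) n (F : seq I -> R) :
  \sum_(s : {ffun 'I_n.+1 -> I}) F [seq s i | i <- enum 'I_n.+1] =
  \sum_(a : I) \sum_(s : {ffun 'I_n -> I}) F (a :: [seq s i | i <- enum 'I_n]).
Proof.
pose h (p : I * {ffun 'I_n -> I}) : {ffun 'I_n.+1 -> I} :=
  [ffun i => if unlift ord0 i is Some j then p.2 j else p.1].
pose g (s : {ffun 'I_n.+1 -> I}) := (s ord0, [ffun j : 'I_n => s (lift ord0 j)]).
rewrite pair_big /= (reindex h) /=; last first.
  exists g => [[a s] _|s _].
  - rewrite /g /h ffunE unlift_none /=; congr pair; apply/ffunP => j.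
    by rewrite !ffunE liftK.
  - apply/ffunP => i; rewrite /h !ffunE; case: unliftP => [j|] -> //=.
    by rewrite ffunE.
apply: eq_bigr => -[a s] _; rewrite enum_ordSl /= ffunE unlift_none; congr (F (_ :: _)).
rewrite -map_comp; apply: eq_map => j /=; by rewrite ffunE liftK.
Qed.

(** * Subprobabilities on words read as concatenations of tokens *)

Section code_weight.
Variables (R : realType) (I : finType) (J : eqType).
Variables (F : seq J) (w : J -> R) (word : J -> seq I) (r : I -> I -> R).

(* Weight of the word [a] read along concatenations of tokens, where [t] is the
   unread part of the current token and [r g x] is the probability of the letter
   [x] when the token predicts [g]. *)
Fixpoint code_weight (t a : seq I) : R :=
  if a is x :: a' then
    match t with
    | g :: t' => r g x * code_weight t' a'
    | [::] => \sum_(j <- F)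
        if word j is g :: t' then w j * (r g x * code_weight t' a') else 0
    end
  else 1.

Hypothesis w0 : forall j, 0 <= w j.
Hypothesis w1 : \sum_(j <- F) w j <= 1.
Hypothesis r0 : forall g x, 0 <= r g x.
Hypothesis r1 : forall g, \sum_x r g x <= 1.

Lemma code_weight_ge0 t a : 0 <= code_weight t a.
Proof.
elim: a t => [|x a IHa] [|g t] //=; last by rewrite mulr_ge0.
by apply: sumr_ge0 => j _; case: (word j) => // g t; rewrite !mulr_ge0.
Qed.

(** Induction on the length for all unread parts [t] at once: a letter contributes a factor
    [\sum_x r g x <= 1], and at a token boundary the weights [w j] again sum to at most 1. *)
Lemma sum_code_weight_le1 n t :
  \sum_(s : {ffun 'I_n -> I}) code_weight t [seq s i | i <- enum 'I_n] <= 1.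
Proof.
elim: n t => [|n IHn] t.
  rewrite (eq_bigr (fun=> 1)); last first.
    by move=> s _; rewrite (size0nil (s := enum 'I_0))// size_enum_ord.
  by rewrite sumr_const card_ffun card_ord expn0.
have step g t' : \sum_x \sum_(s : {ffun 'I_n -> I})
    r g x * code_weight t' [seq s i | i <- enum 'I_n] <= 1.
  apply: le_trans (r1 g); apply: ler_sum => x _.
  by rewrite -mulr_sumr ler_piMr.
rewrite sum_ffun_ordS; case: t => [|g t] /=; last exact: step.
under eq_bigr => x _ do rewrite exchange_big.
rewrite exchange_big (le_trans _ w1)//=; apply: ler_sum => j _.
case: (word j) => [|g t].
  by rewrite big1 // => x _; rewrite big1.
under eq_bigr => x _ do rewrite -mulr_sumr.
by rewrite -mulr_sumr ler_piMr.
Qed.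

Variables (T : Type) (f : T -> T) (name : T -> I) (e v : T -> R) (L : nat) (B : R).

(** [e] is the price of encoding the letter at a point given its prediction; [v] will be the price
    of the token per unit of time. *)
Definition follows (t : seq I) (x : T) : Prop :=
  forall i (g : I), (i < size t)%N ->
    expR (- e (iter i f x)) <= r (nth g t i) (name (iter i f x)).

Hypothesis choose : forall x, exists2 j, j \in F &
  [/\ word j != [::], (size (word j) <= L)%N, follows (word j) x &
      expR (- \sum_(i < size (word j)) v (iter i f x)) <= w j].
Hypothesis vB : forall x n, (n <= L)%N -> \sum_(i < n) v (iter i f x) <= B.

(* Invariant: the part [t] of the current token that is still to be read has
   already been paid for. *)
Lemma code_weight_ge n t x : (size t <= L)%N -> follows t x ->
  expR (- (\sum_(j < n) (e (iter j f x) + v (iter j f x))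
            - \sum_(j < size t) v (iter j f x) + B))
  <= code_weight t [seq name (iter j f x) | j <- iota 0 n].
Proof.
have names_shift m y : [seq name (iter j f y) | j <- iota 1 m] =
    [seq name (iter j f (f y)) | j <- iota 0 m].
  by rewrite -[1%N]addn0 iotaDl -map_comp; apply: eq_map => j /=; rewrite -iterSr.
have sum_shift (u : T -> R) m y : \sum_(j < m.+1) u (iter j f y) =
    u y + \sum_(j < m) u (iter j f (f y)).
  by rewrite big_ord_recl /=; congr (_ + _); apply: eq_bigr => j _; rewrite -iterSr.
have foll_shift g s y : follows (g :: s) y -> follows s (f y).
  by move=> fl i g' si; have := fl i.+1 g' si; rewrite /= -iterSr.
(* Reading one letter costs only [e y]: the term [v y] cancels, as this time belongs to a token
   already paid for. *)
have cons_step m g s y : follows (g :: s) y ->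
    expR (- (\sum_(j < m) (e (iter j f (f y)) + v (iter j f (f y)))
            - \sum_(j < size s) v (iter j f (f y)) + B))
      <= code_weight s [seq name (iter j f (f y)) | j <- iota 0 m] ->
    expR (- (\sum_(j < m.+1) (e (iter j f y) + v (iter j f y))
            - \sum_(j < size (g :: s)) v (iter j f y) + B))
      <= r g (name y) * code_weight s [seq name (iter j f (f y)) | j <- iota 0 m].
  move=> fl IH; rewrite (sum_shift (fun z => e z + v z)) (sum_shift v).
  have -> : - (e y + v y + \sum_(i < m) (e (iter i f (f y)) + v (iter i f (f y))) -
     (v y + \sum_(j < size s) v (iter j f (f y))) + B) =
     (- e y) + (- (\sum_(i < m) (e (iter i f (f y)) + v (iter i f (f y))) -
     (\sum_(j < size s) v (iter j f (f y))) + B)) by lra.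
  rewrite expRD; apply: ler_pM; rewrite ?expR_ge0//.
  by have := fl 0%N g isT.
elim: n t x => [|n IHn] [|g t] x st fl.
- rewrite !big_ord0 /= subr0 add0r -expR0 ler_expR lerNl oppr0.
  by have := vB x (leq0n L); rewrite big_ord0.
(* The name ends inside a token: its unread part was paid for in advance, and [B] absorbs this. *)
- rewrite big_ord0 /= -expR0 ler_expR lerNl oppr0 sub0r addrC subr_ge0.
  exact: vB.
- rewrite big_ord0 subr0 /= names_shift.
  (* At a token boundary the sum over tokens dominates its term for the chosen [j], whose weight
     pays for the whole token at once. *)
  have [j jF [+ + + wj]] := choose x.
  set rhs := (X in _ <= X).
  have : (if word j is g :: t' then w j * (r g (name x) *
      code_weight t' [seq name (iter i f (f x)) | i <- iota 0 n]) else 0) <= rhs.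
    rewrite /rhs (big_rem j jF) /= lerDl sumr_ge0// => i _.
    by case: (word i) => // g t; rewrite !mulr_ge0 ?code_weight_ge0.
  move: wj; case: (word j) => [//|g t] wj le_rhs _ st' fl'.
  apply: le_trans le_rhs.
  have IH := cons_step n g t x fl' (IHn _ _ (ltnW st') (foll_shift _ _ _ fl')).
  have -> : - (\sum_(j0 < n.+1) (e (iter j0 f x) + v (iter j0 f x)) + B) =
     - \sum_(i < size (g :: t)) v (iter i f x)
     - (\sum_(j0 < n.+1) (e (iter j0 f x) + v (iter j0 f x))
     - \sum_(i < size (g :: t)) v (iter i f x) + B) by lra.
  by rewrite expRD; apply: ler_pM; rewrite ?expR_ge0.
- rewrite /= names_shift; apply: cons_step => //.
  apply: IHn; [exact: ltnW|exact: foll_shift fl].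
Qed.

End code_weight.

(** * Entropy of finite partitions *)

Section finite_valued.
Context d (T : measurableType d) (R : realType) (mu : probability T R).

Definition measurable_fibers (J : Type) (nu : T -> J) :=
  forall j, measurable (nu @^-1` [set j]).

Definition law (J : Type) (nu : T -> J) (j : J) : R :=
  fine (mu (nu @^-1` [set j])).

Lemma measurable_fibers_preimage (J : finType) (nu : T -> J) (Y : set J) :
  measurable_fibers nu -> measurable (nu @^-1` Y).
Proof.
move=> mnu; have -> : nu @^-1` Y = \bigcup_(j in Y) (nu @^-1` [set j]).
  by apply/seteqP; split=> [x /= Yx|x [j Yj /= ->]//]; exists (nu x).
by apply: fin_bigcup_measurable => //; exact: finite_finset.
Qed.

Lemma measurable_fibers_comp (J K : finType) (nu : T -> J) (p : J -> K) :
  measurable_fibers nu -> measurable_fibers (p \o nu).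
Proof.
by move=> mnu k; rewrite comp_preimage; exact: measurable_fibers_preimage.
Qed.

Lemma law_ge0 (J : Type) (nu : T -> J) j : 0 <= law nu j.
Proof. by rewrite fine_ge0. Qed.

Lemma bounded_integrable (g : T -> R) (M : R) : measurable_fun setT g ->
  (forall x, `|g x| <= M) -> mu.-integrable setT (EFin \o g).
Proof.
move=> mg gM; apply: measurable_bounded_integrable => //.
  by rewrite -ge0_fin_numE// fin_num_measure.
by exists M; split; [exact: num_real | move=> N /ltW MN x _; exact: le_trans MN].
Qed.

Lemma finite_valued_integrable (J : finType) (nu : T -> J) (c : J -> R) :
  measurable_fibers nu -> mu.-integrable setT (EFin \o (c \o nu)).
Proof.
move=> mnu; apply: (@bounded_integrable _ (\sum_j `|c j|)).
  by move=> _ Y mY; rewrite setTI comp_preimage; exact: measurable_fibers_preimage.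
by move=> x; rewrite (bigD1 (nu x))//= lerDl sumr_ge0.
Qed.

Lemma Rintegral_const (c : R) : \int[mu]_x c = c.
Proof.
rewrite Rintegral_cst// -[RHS]mulr1; congr (_ * _).
exact: (congr1 fine (probability_setT mu)).
Qed.

Lemma Rintegral_sum (I : Type) (s : seq I) (g : I -> T -> R) :
  (forall i, mu.-integrable setT (EFin \o g i)) ->
  \int[mu]_x (\sum_(i <- s) g i x) = \sum_(i <- s) \int[mu]_x g i x.
Proof.
move=> ig; elim: s => [|i s IHs].
  under eq_Rintegral do rewrite big_nil.
  by rewrite Rintegral_const big_nil.
under eq_Rintegral do rewrite big_cons.
rewrite big_cons RintegralD ?IHs//.
have -> : EFin \o (fun x => \sum_(j <- s) g j x) =
    (fun x => \sum_(j <- s) (g j x)%:E)%E.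
  by apply/funext => x /=; rewrite sumEFin.
by apply: integrable_sum => // j _; exact: ig.
Qed.

Lemma indic_integrable (A : set T) (c : R) : measurable A ->
  mu.-integrable setT (EFin \o (fun x => c * \1_A x)).
Proof.
move=> mA; apply: (@bounded_integrable _ `|c|).
  by apply: measurable_funM => //; exact: measurable_indic.
move=> x; rewrite normrM indicE; case: (_ \in _).
  by rewrite normr1 mulr1.
by rewrite normr0 mulr0.
Qed.

Lemma Rintegral_indic (A : set T) (c : R) : measurable A ->
  \int[mu]_x (c * \1_A x) = c * fine (mu A).
Proof.
move=> mA; rewrite RintegralZl//.
  by congr (_ * _); rewrite /Rintegral integral_indic// setIT.
have := indic_integrable 1 mA; congr (mu.-integrable _ _).
by apply/funext => x /=; rewrite mul1r.
Qed.

Lemma Rintegral_finite_valued (J : finType) (nu : T -> J) (c : J -> R) :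
  measurable_fibers nu -> \int[mu]_x c (nu x) = \sum_j law nu j * c j.
Proof.
move=> mnu.
have -> : (fun x => c (nu x)) =
    (fun x => \sum_j c j * \1_(nu @^-1` [set j]) x).
  apply/funext => x; rewrite (bigD1 (nu x))//= big1 ?addr0.
    by rewrite indicE mem_set ?mulr1.
  by move=> j jx; rewrite indicE memNset ?mulr0// => /= /esym/eqP; exact/negP.
rewrite Rintegral_sum => [|j]; last exact: indic_integrable.
by apply: eq_bigr => j _; rewrite Rintegral_indic// mulrC.
Qed.

Lemma sum_law (J : finType) (nu : T -> J) :
  measurable_fibers nu -> \sum_j law nu j = 1.
Proof.
move=> mnu; have := Rintegral_finite_valued (fun=> 1) mnu.
rewrite Rintegral_const => ->.
by apply: eq_bigr => j _; rewrite mulr1.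
Qed.

Lemma sum_law_comp (J K : finType) (nu : T -> J) (p : J -> K) (c : K -> R) :
  measurable_fibers nu ->
  \sum_j law nu j * c (p j) = \sum_k law (p \o nu) k * c k.
Proof.
move=> mnu; rewrite -(Rintegral_finite_valued (c \o p))//.
by rewrite -Rintegral_finite_valued//; exact: measurable_fibers_comp.
Qed.

(** The tangent line bound [ln y <= y - 1] at [y = q / p], multiplied by [p]. *)
Lemma neg_xlnx_le (p q : R) : 0 <= p -> (0 < p -> 0 < q) -> 0 <= q ->
  neg_xlnx p <= p * - ln q + (q - p).
Proof.
rewrite le_eqVlt => /predU1P[<- _ q0|p0 /(_ p0) q0 _].
  by rewrite /neg_xlnx !mul0r oppr0 add0r addr0.
have : ln (q / p) <= q / p - 1.
  rewrite -{1}(subrKC 1 (q / p)) le_ln1Dx//.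
  by rewrite -subr_gt0 opprK subrK divr_gt0.
rewrite ln_div ?posrE// -(ler_pM2l p0) !mulrBr mulrCA divff ?gt_eqF// !mulr1.
rewrite /neg_xlnx mulrN; lra.
Qed.

(** The defects [q j - law nu j] of the tangent line bounds sum to at most 0. The last hypothesis is
    absolute continuity: since [ln 0 = 0], a value with [q j = 0] would otherwise cost nothing. *)
Lemma gibbs_inequality (J : finType) (nu : T -> J) (q : J -> R) :
  measurable_fibers nu -> (forall j, 0 <= q j) -> \sum_j q j <= 1 ->
  (forall j, 0 < law nu j -> 0 < q j) ->
  \sum_j neg_xlnx (law nu j) <= \sum_j law nu j * - ln (q j).
Proof.
move=> mnu q0 q1 lq.
apply: (@le_trans _ _ (\sum_j (law nu j * - ln (q j) + (q j - law nu j)))).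
  by apply: ler_sum => j _; rewrite neg_xlnx_le ?law_ge0//; exact: lq.
by rewrite big_split /= sumrB sum_law// gerDl subr_le0.
Qed.

End finite_valued.

(** * Entropy of itineraries under an invariant measure *)

Section itinerary.
Context d (T : measurableType d) (R : realType) (mu : probability T R).
Variables (f : T -> T) (mf : measurable_fun setT f).
Hypothesis fmu : forall A, measurable A -> mu (f @^-1` A) = mu A.

Lemma measurable_iter n : measurable_fun setT (iter n f).
Proof.
elim: n => [|n IHn]; first exact: measurable_id.
rewrite (_ : iter n.+1 f = f \o iter n f)//; exact: measurableT_comp.
Qed.

Lemma measurable_iter_preimage n A : measurable A -> measurable (iter n f @^-1` A).
Proof. by move=> mA; rewrite -[X in measurable X]setTI; exact: measurable_iter. Qed.

Lemma invariant_iter n A : measurable A -> mu (iter n f @^-1` A) = mu A.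
Proof.
move=> mA; elim: n => // n IHn; rewrite -[RHS]IHn.
rewrite -(fmu (measurable_iter_preimage n mA)); congr (mu _).
by apply/funext => x; rewrite /preimage /= -iterSr.
Qed.

Lemma Rintegral_iter n (g : T -> R) (M : R) : measurable_fun setT g ->
  (forall x, `|g x| <= M) -> \int[mu]_x g (iter n f x) = \int[mu]_x g x.
Proof.
move=> mg gM; congr fine; have mi := measurable_iter n.
transitivity (\int[pushforward mu (iter n f)]_x (g x)%:E)%E; last first.
  by apply: eq_measure_integral => A mA _; exact: invariant_iter.
rewrite integral_pushforward//; first exact/measurable_EFinP.
rewrite preimage_setT.
apply: (@bounded_integrable _ _ _ _ (g \o iter n f) M) => [|x].
  exact: measurableT_comp.
exact: gM.
Qed.

Variables (k : nat) (nu : T -> 'I_k).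
Hypothesis mnu : measurable_fibers nu.

(** A single finite-valued map whose fibres are the atoms of the join, so that [join_entropy]
    becomes the entropy of a law. *)
Definition itinerary n (x : T) : {ffun 'I_n -> 'I_k} :=
  [ffun j : 'I_n => nu (iter j f x)].

Lemma join_atom_itinerary n (s : {ffun 'I_n -> 'I_k}) :
  join_atom f (fun i => nu @^-1` [set i]) s = @itinerary n @^-1` [set s].
Proof.
apply/seteqP; split=> x /= h; first by apply/ffunP => j; rewrite ffunE; exact: h.
by move=> j; rewrite -h ffunE.
Qed.

Lemma measurable_itinerary n : measurable_fibers (@itinerary n).
Proof.
move=> s; rewrite -join_atom_itinerary.
rewrite (_ : join_atom _ _ _ =
    \bigcap_(j in [set: 'I_n]) (iter j f @^-1` (nu @^-1` [set s j]))).
  apply: fin_bigcap_measurable => // j _; exact: measurable_iter_preimage.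
by apply/seteqP; split=> x h j; [move=> _|]; exact: h.
Qed.

Lemma join_entropy_itinerary n :
  join_entropy mu f (fun i => nu @^-1` [set i]) n =
  \sum_s neg_xlnx (law mu (@itinerary n) s).
Proof. by apply: eq_bigr => s _; rewrite join_atom_itinerary. Qed.

Lemma law_le1 (J : Type) (xi : T -> J) j :
  measurable_fibers xi -> law mu xi j <= 1.
Proof.
move=> mxi; rewrite /law -lee_fin fineK ?probability_le1//.
exact: fin_num_measure.
Qed.

Lemma join_entropy_ge0 n : 0 <= join_entropy mu f (fun i => nu @^-1` [set i]) n.
Proof.
rewrite join_entropy_itinerary sumr_ge0// => s _; rewrite /neg_xlnx oppr_ge0.
rewrite mulr_ge0_le0 ?law_ge0 ?ln_le0//.
exact/law_le1/measurable_itinerary.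
Qed.

(** Gibbs' inequality for the law of the first [m + n] letters against the product of the laws of
    the first [m] and the last [n] of them; by invariance the latter is the law of [itinerary n]. *)
Lemma join_entropy_subadditive m n :
  join_entropy mu f (fun i => nu @^-1` [set i]) (m + n) <=
  join_entropy mu f (fun i => nu @^-1` [set i]) m +
  join_entropy mu f (fun i => nu @^-1` [set i]) n.
Proof.
rewrite !join_entropy_itinerary.
pose pl (s : {ffun 'I_(m + n) -> 'I_k}) : {ffun 'I_m -> 'I_k} :=
  [ffun j : 'I_m => s (lshift n j)].
pose pr (s : {ffun 'I_(m + n) -> 'I_k}) : {ffun 'I_n -> 'I_k} :=
  [ffun j : 'I_n => s (rshift m j)].
have plE : pl \o @itinerary (m + n) = @itinerary m.
  by apply/funext => x; apply/ffunP => j; rewrite !ffunE.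
have prE : pr \o @itinerary (m + n) = @itinerary n \o iter m f.
  by apply/funext => x; apply/ffunP => j; rewrite !ffunE /= addnC iterD.
have lawr u : law mu (pr \o @itinerary (m + n)) u = law mu (@itinerary n) u.
  rewrite prE /law comp_preimage invariant_iter//; exact: measurable_itinerary.
have mi := @measurable_itinerary.
have mpl := measurable_fibers_comp pl (mi (m + n)%N).
have mpr := measurable_fibers_comp pr (mi (m + n)%N).
have law_mono (J : finType) (p : {ffun 'I_(m + n) -> 'I_k} -> J) s :
    law mu (@itinerary (m + n)) s <= law mu (p \o @itinerary (m + n)) (p s).
  have mps := measurable_fibers_comp p (mi (m + n)%N) (p s).
  have ms := mi (m + n)%N s.
  apply: fine_le; [exact: fin_num_measure|exact: fin_num_measure|].
  by apply: le_measure; rewrite ?inE// => x /= ->.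
pose q s := law mu (@itinerary m) (pl s) * law mu (@itinerary n) (pr s).
have q0 s : 0 < law mu (@itinerary (m + n)) s ->
    0 < law mu (@itinerary m) (pl s) /\ 0 < law mu (@itinerary n) (pr s).
  move=> s0; split; first by rewrite -plE (lt_le_trans s0).
  by rewrite -lawr (lt_le_trans s0).
have qsum : \sum_s q s = 1.
  pose g (s : {ffun 'I_(m + n) -> 'I_k}) := (pl s, pr s).
  (* Concatenation, inverse to the splitting [g]; it turns the sum of [q] into a product of two
     total masses. *)
  pose h (p : {ffun 'I_m -> 'I_k} * {ffun 'I_n -> 'I_k}) : {ffun 'I_(m + n) -> 'I_k} :=
    [ffun i : 'I_(m + n) =>
      match fintype.split i with inl a => p.1 a | inr b => p.2 b end].
  rewrite (reindex h) /=; last first.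
    exists g => [[u v] _|s _].
      rewrite /g /h; congr pair; apply/ffunP => j; rewrite !ffunE.
        by rewrite (unsplitK (inl j)).
      by rewrite (unsplitK (inr j)).
    apply/ffunP => i; rewrite !ffunE /=.
    by case: (split_ordP i) => j ->;
      rewrite ?(unsplitK (inl j)) ?(unsplitK (inr j)) ffunE.
  have -> : \sum_p q (h p) = \sum_p law mu (@itinerary m) p.1 * law mu (@itinerary n) p.2.
    apply: eq_bigr => -[u v] _; rewrite /q;
      congr (law mu (@itinerary m) _ * law mu (@itinerary n) _);
      apply/ffunP => j; rewrite !ffunE.
      by rewrite (unsplitK (inl j)).
    by rewrite (unsplitK (inr j)).
  rewrite -(pair_big xpredT xpredT
    (fun u v => law mu (@itinerary m) u * law mu (@itinerary n) v)) /=.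
  under eq_bigr => u _ do rewrite -mulr_sumr (sum_law _ (mi n)) mulr1.
  exact: (sum_law mu (mi m)).
apply: (@le_trans _ _ (\sum_s law mu (@itinerary (m + n)) s * - ln (q s))).
  apply: (gibbs_inequality (mi _)) => [s||s /q0[? ?]].
  - by rewrite /q mulr_ge0 ?law_ge0.
  - by rewrite qsum.
  - by rewrite /q mulr_gt0.
rewrite (_ : \sum_s _ = \sum_s (
   law mu (@itinerary (m + n)) s * - ln (law mu (@itinerary m) (pl s)) +
   law mu (@itinerary (m + n)) s * - ln (law mu (@itinerary n) (pr s)))); last first.
  (* Where the law vanishes both sides are 0; elsewhere the two factors of [q s] are positive and
     the logarithm splits. *)
  apply: eq_bigr => s _; rewrite -mulrDr.
  have := law_ge0 mu (@itinerary (m + n)) s; rewrite le_eqVlt => /predU1P[<-|].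
    by rewrite !mul0r.
  by move=> /q0[? ?]; rewrite /q lnM ?posrE// opprD.
have El := sum_law_comp mu pl (fun u => - ln (law mu (@itinerary m) u)) (mi (m + n)%N).
have Er := sum_law_comp mu pr (fun u => - ln (law mu (@itinerary n) u)) (mi (m + n)%N).
rewrite big_split /= El Er plE.
by apply: lerD; apply: ler_sum => s _; rewrite /neg_xlnx ?lawr mulrN.
Qed.

(* [limn] would be a junk value if the sequence diverged, hence Fekete's lemma. *)
Lemma partition_entropy_le (a b : R) :
  (forall n, join_entropy mu f (fun i => nu @^-1` [set i]) n <= n%:R * a + b) ->
  partition_entropy mu f (fun i => nu @^-1` [set i]) <= a.
Proof.
move=> Hab; rewrite /partition_entropy.
have cH := fekete join_entropy_ge0 join_entropy_subadditive.
apply/ler_addgt0Pr => e e0; apply: limr_le => //.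
near=> n.
have n0 : 0 < n%:R :> R by rewrite ltr0n; near: n; exists 1%N.
rewrite ler_pdivrMr// (le_trans (Hab n))// mulrDl mulrC lerD2l.
by rewrite mulrC -ler_pdivrMr//; near: n; exact: nbhs_infty_ger.
Unshelve. all: by end_near. Qed.

(** The cross entropy in Gibbs' inequality is the integral of [- ln (q (itinerary x))], which [g]
    bounds pointwise. *)
Lemma join_entropy_le_Rintegral n (q : {ffun 'I_n -> 'I_k} -> R)
    (g : T -> R) (M : R) :
  (forall s, 0 <= q s) -> \sum_s q s <= 1 ->
  measurable_fun setT g -> (forall x, `|g x| <= M) ->
  (forall x, expR (- g x) <= q (@itinerary n x)) ->
  join_entropy mu f (fun i => nu @^-1` [set i]) n <= \int[mu]_x g x.
Proof.
move=> q0 q1 mg gM gq; rewrite join_entropy_itinerary.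
have mi := @measurable_itinerary n.
apply: (le_trans (gibbs_inequality mi q0 q1 _)) => [s ls|].
  (* A name of positive probability is the name of some point, where the pointwise bound makes [q]
     positive. *)
  have [[x xs]|] := pselect (exists x, @itinerary n x = s).
    by rewrite -xs (lt_le_trans _ (gq x))// expR_gt0.
  move=> ns; move: ls; rewrite /law (_ : _ @^-1` _ = set0) ?measure0 ?ltxx//.
  by apply/seteqP; split=> // x xs; apply: ns; exists x.
rewrite -(Rintegral_finite_valued mu (fun s => - ln (q s)))//.
apply: le_Rintegral => // [| |x _].
- exact: (@finite_valued_integrable _ _ _ _ _ (@itinerary n) (fun s => - ln (q s))).
- exact: bounded_integrable gM.
- by rewrite lerNl -ler_expR lnK ?posrE ?(lt_le_trans (expR_gt0 _) (gq x)).
Qed.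

End itinerary.

(** * Metrics on the one-point compactification *)

Section metrizes.
Context (R : realType) (T : topologicalType) (d : T -> T -> R).
Hypothesis dP : metrizes d.

Lemma metrizes_xx x : d x x = 0.
Proof. by case: dP => /(_ x x)[_ ->]. Qed.

Lemma metrizes_nbhs x e : 0 < e -> nbhs x [set y | d x y < e].
Proof. by case: dP => _ _ _ /(_ x) -> e0; exists e. Qed.

Lemma metrizes_open x e : open [set y | d x y < e].
Proof.
rewrite openE => y /= xy; case: dP => _ _ tri nb; rewrite /interior nb.
exists (e - d x y); first by rewrite /= subr_gt0.
by move=> z /= yz; rewrite (le_lt_trans (tri x y z))// addrC -ltrBrDr.
Qed.

(** If the ball of radius [r] at [x] lies in [U], every [e < r / 2] works at all points within
    [r / 2] of [x]; the near-covering form of compactness makes [e] uniform. *)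
Lemma metrizes_lebesgue_number (P : set (set T)) : compact [set: T] ->
  (forall x, exists2 U, P U & nbhs (x : T) U) ->
  exists2 e : R, 0 < e & forall x, exists2 U, P U & [set y | d x y < e] `<=` U.
Proof.
move=> /compact_near_coveringP cT PT.
pose Q (e : R) x := exists2 U, P U & [set y | d x y < e] `<=` U.
have [|e [H e0]] := @filter_ex _ (0 : R)^'+ _ (fun e => [set: T] `<=` Q e /\ 0 < e).
  apply: filterI; last exact: nbhs_right_gt.
  apply: (cT _ (0 : R)^'+ Q) => x _; have [U PU] := PT x.
  case: (dP) => _ dC tri nb; rewrite nb => -[r /= r0 rU].
  exists ([set y | d x y < r / 2], [set e | e < r / 2]).
    split; first by apply: metrizes_nbhs; rewrite divr_gt0.
    by apply: nbhs_right_lt; rewrite divr_gt0.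
  move=> [y e] [/= xy er]; exists U => // z /= yz; apply: rU => /=.
  by rewrite (le_lt_trans (tri x y z))// (splitr r) ltrD// (lt_trans yz).
by exists e => // x; exact: H.
Qed.

(** A Lebesgue number for the family of sets on which [g] varies by less than [e]. *)
Lemma metrizes_unif_continuous (g : T -> R) : compact [set: T] ->
  continuous g -> forall e, 0 < e -> exists2 r : R, 0 < r &
    forall x y, d x y < r -> `|g x - g y| < e.
Proof.
move=> cT cg e e0.
have [] := @metrizes_lebesgue_number
  [set U | forall x y, U x -> U y -> `|g x - g y| < e] cT.
  move=> x; exists [set y | `|g x - g y| < e / 2]; last first.
    by move/cvgrPdist_lt : (cg x); apply; rewrite divr_gt0.
  move=> y z /= xy xz; rewrite -(subrKA (g x)) (splitr e).
  by rewrite (le_lt_trans (ler_normD _ _))// ltrD// distrC.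
move=> r r0 Hr; exists r => // x y xy; have [U PU rU] := Hr x.
by apply: PU; apply: rU => //=; rewrite metrizes_xx.
Qed.

End metrizes.

(** * Admissible covers as traces of covers of the compactification *)

Section one_point_metric.
Context (R : realType) (X : pmetricType R).
Context (dt : one_point_compactification X -> one_point_compactification X -> R).
Hypothesis dtP : metrizes dt.
Let d := fun x y : X => dt (Some x) (Some y).

Lemma one_point_dist_open x e : open [set y | d x y < e].
Proof.
move/continuousP : (@one_point_compactification_some_continuous X).
by move=> /(_ _ (metrizes_open dtP (Some x) e)).
Qed.

Lemma diam_lt (A : set X) e x y : (diam d A < e%:E)%E -> A x -> A y -> d x y < e.
Proof.
move=> Ae Ax Ay; rewrite -lte_fin; apply: le_lt_trans Ae.
by apply: ereal_sup_ubound; right; exists (x, y).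
Qed.

Lemma cover_diam_lt (C : set (set X)) U e x y :
  (cover_diam d C < e%:E)%E -> C U -> U x -> U y -> d x y < e.
Proof.
move=> Ce CU; apply: diam_lt; apply: le_lt_trans Ce.
by apply: ereal_sup_ubound; exists U.
Qed.

(** At infinity, an element with compact complement gives a neighbourhood. If there is none, all
    closures are compact, hence [X] is a finite union of compact sets and infinity is isolated. *)
Lemma admissible_one_point_nbhs (C : set (set X)) : admissible_cover C ->
  forall z : one_point_compactification X, exists2 W,
    (exists2 U, C U & Some @^-1` W `<=` U) & nbhs z W.
Proof.
move=> [finC admC covC] [x|].
  have : (\bigcup_(U in C) U) x by rewrite covC.
  move=> [U CU Ux]; exists (Some @` U).
    by exists U => // y [z Uz [<-]].
  apply: one_point_compactification_some_nbhs; apply: open_nbhs_nbhs.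
  by split => //; have [] := admC _ CU.
have [[U [CU cU]]|nC] := pselect (exists U, C U /\ compact (~` U)).
  exists (Some @` U `|` [set None]).
    by exists U => // y [[z Uz [<-]]|//].
  exists (~` U); last by rewrite setCK.
  by split=> //; apply: open_closedC; have [] := admC _ CU.
(* Any element serves here, because [[set None]] has empty trace on [X]. *)
have [U CU _] : (\bigcup_(U in C) U) point by rewrite covC.
exists [set None]; first by exists U => // y.
exists setT; last by rewrite setCT image_set0 set0U.
split; last exact: closedT.
have -> : [set: X] = \bigcup_(U in C) closure U.
  apply/seteqP; split=> // x _.
  have : (\bigcup_(U in C) U) x by rewrite covC.
  by move=> [V CV Vx]; exists V => //; exact: subset_closure.
rewrite -bigsetU_fset_set// big_seq.
apply: (@bigsetU_compact _ _ (@closure X)) => V.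
rewrite in_fset_set// => /set_mem CV.
by have [_ []// cV] := admC _ CV; exfalso; apply: nC; exists V.
Qed.

(** [X] itself may be noncompact, so the Lebesgue number is taken on the compactification, over
    which the cover extends. *)
Lemma admissible_cover_refine (C : set (set X)) : admissible_cover C ->
  exists2 e : R, 0 < e & forall V : set X, (diam d V < e%:E)%E ->
    exists2 U, C U & V `<=` U.
Proof.
move=> aC; have [e e0 He] := metrizes_lebesgue_number dtP
  one_point_compactification_compact (admissible_one_point_nbhs aC).
exists e => // V Ve; have [[v Vv]|/nonemptyPn ->] := pselect (V !=set0); last first.
  have [_ _ covC] := aC.
  have [U CU _] : (\bigcup_(U in C) U) point by rewrite covC.
  by exists U.
have [W [U CU WU] eW] := He (Some v).
by exists U => // x Vx; apply: WU; apply: eW; exact: diam_lt Ve Vv Vx.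
Qed.

(** Traces of a finite cover of the compactification by small open sets: those at points of [X] are
    shrunk into a compact neighbourhood, the one at infinity has compact complement. *)
Lemma small_covers_ex (lcX : locally_compact [set: X]) e : 0 < e ->
  exists2 C : set (set X), admissible_cover C & (cover_diam d C < e%:E)%E.
Proof.
move=> e0.
case: (dtP) => _ dC tri _.
have W_ z : exists W : set (one_point_compactification X),
   [/\ open W, W z, W `<=` [set y | dt z y < e / 4] & admissible (Some @^-1` W : set X)].
  case: z => [x|].
    have [K + [cK clK]] := lcX x I; rewrite withinET => xK.
    exists (Some @` (K° `&` [set y | d x y < e / 4])).
    have oU : open (K° `&` [set y | d x y < e / 4]).
      by apply: openI; [exact: open_interior|exact: one_point_dist_open].
    split.
    - exact: one_point_compactification_open_some.
    - by exists x => //; split => //=; rewrite /d metrizes_xx// divr_gt0.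
    - by move=> y [z [_ ?] <-].
    - rewrite (_ : _ @^-1` _ = K° `&` [set y | d x y < e / 4]); last first.
        by apply/seteqP; split=> [y [z ? [<-]]//|y ?]; exists y.
      split=> //; left; apply: (subclosed_compact _ cK); first exact: closed_closure.
      rewrite {2}((closure_id K).1 clK); apply: closureS => y [+ _].
      exact: interior_subset.
  exists [set y | dt None y < e / 4].
  have o := metrizes_open dtP None (e / 4).
  split => //; first by rewrite /= metrizes_xx// divr_gt0.
  have oU : open (Some @^-1` [set y | dt None y < e / 4] : set X).
    by move/continuousP : (@one_point_compactification_some_continuous X); exact.
  split=> //; right.
  have : nbhs (None : one_point_compactification X) [set y | dt None y < e / 4].
    by apply: metrizes_nbhs => //; rewrite divr_gt0.
  move=> [K [cK clK] KW]; apply: (subclosed_compact _ cK); first exact: open_closedC.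
  by move=> x; apply: contra_notP => nKx; apply: KW; left; exists x.
have [W WP] := choice W_.
have [S finS Scov] : exists2 S, finite_set S &
    [set: one_point_compactification X] `<=` cover S W.
  have := @one_point_compactification_compact X.
  rewrite compact_cover => /(_ _ setT W)[z _|z _|D _ Dcov].
  - by have [] := WP z.
  - by exists z => //; have [] := WP z.
  - by eexists; [exact: (finite_fset D)|exact: Dcov].
exists [set (Some @^-1` (W z) : set X) | z in S].
  split; first by apply: finite_image.
    by move=> _ [z _ <-]; have [] := WP z.
  apply/seteqP; split=> // x _; have [z Dz Wz] := Scov (Some x) I.
  by exists (Some @^-1` W z) => //; exists z.
(* Radii [e / 4] give diameters at most [e / 2], which keeps the bound strict after the suprema. *)
apply: (@le_lt_trans _ _ (e / 2)%:E); last first.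
  by rewrite lte_fin ltr_pdivrMr// ltr_pMr// ltr1n.
apply: ge_ereal_sup => _ [_ [z _ <-] <-]; apply: ge_ereal_sup.
move=> _ [->|[[x y] [/= Wx Wy] <-]]; first by rewrite lee_fin divr_ge0// ltW.
have [_ _ We _] := WP z; rewrite lee_fin.
rewrite (le_trans (tri _ z _))// dC.
have := We _ Wx; have := We _ Wy; rewrite /=; lra.
Qed.

End one_point_metric.

(** * Convergence of the pressure over small covers *)

Lemma esum_subset (R : realType) (T : choiceType) (P Q : set T)
    (a : T -> \bar R) : P `<=` Q -> (\esum_(i in P) a i <= \esum_(i in Q) a i)%E.
Proof.
move=> PQ; apply: ereal_sup_le => _ [A [finA AP] <-]; exists A => //.
by split => //; exact: subset_trans PQ.
Qed.

(** As [g] may identify indices, the sum over the image is compared with the sum over one chosen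
    preimage of each point. *)
Lemma esum_image_le (R : realType) (T T' : choiceType) (P : set T)
    (g : T -> T') (a : T -> \bar R) (b : T' -> \bar R) :
  (forall x, P x -> (b (g x) <= a x)%E) ->
  (\esum_(y in g @` P) b y <= \esum_(x in P) a x)%E.
Proof.
move=> ba; have [[x0 _]|/nonemptyPn ->] := pselect (P !=set0); last first.
  by rewrite image_set0 !esum_set0.
have /choice[h hP] y : exists x, (g @` P) y -> P x /\ g x = y.
  by have [[x Px xy]|ny] := pselect ((g @` P) y); [exists x|exists x0].
have hinj : set_inj (g @` P) h.
  by move=> y z /set_mem/hP[_ {2}<-] /set_mem/hP[_ {2}<-] ->.
apply: (@le_trans _ _ (\esum_(y in g @` P) a (h y))%E).
  by apply: le_esum => y /hP[Ph {1}<-]; exact: ba.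
rewrite -(esum_image _ h)//; apply: esum_subset => _ [y Py <-].
by have [] := hP _ Py.
Qed.

(** One-sided bounds that also make sense for an infinite limit: lower bounds by every [x < L], and
    upper bounds up to a real error. *)
Lemma ereal_cvg_filter (R : realType) (T : Type) (F : set_system T)
    (g : T -> \bar R) (L : \bar R) : Filter F ->
  (forall x, (x < L)%E -> \forall t \near F, (x <= g t)%E) ->
  (forall e : R, 0 < e -> \forall t \near F, (g t <= L + e%:E)%E) ->
  g t @[t --> F] --> L.
Proof.
move=> FF; case: L => [r||] lo up.
- have lo' e : 0 < e -> \forall t \near F, ((r - e)%:E <= g t)%E.
    by move=> e0; apply: lo; rewrite lte_fin ltrBlDr ltrDl.
  have near_fin e : 0 < e ->
      \forall t \near F, `|r - fine (g t)| <= e /\ g t \is a fin_num.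
    move=> e0; near=> t.
    have : ((r - e)%:E <= g t)%E by near: t; exact: lo'.
    have : (g t <= r%:E + e%:E)%E by near: t; exact: up.
    case: (g t) => [s| |]; rewrite ?leeNy_eq// -EFinD !lee_fin => h1 h2.
    by split=> //=; rewrite distrC ler_distl; apply/andP; split.
  apply/fine_cvgP; split; first by apply: filterS (near_fin 1 ltr01) => t [].
  by apply/cvgrPdist_le => e /near_fin; apply: filterS => t [].
- by apply/cvgeyPge => A; apply: lo; rewrite ltry.
- apply/cvgeNyPle => A; apply: filterS (up 1 ltr01) => t.
  by rewrite addNye leeNy_eq => /eqP ->; rewrite leNye.
Unshelve. all: by end_near. Qed.

(** * Comparison of the pressures of a cover and a refinement *)

Section pressure_facts.
Context (R : realType) (X : pmetricType R).
Context (d : X -> X -> R) (f : X -> X) (phi : X -> R).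

Lemma string_weight_ge0 a s : (0 <= string_weight f phi a s)%E.
Proof. exact: expeR_ge0. Qed.

Lemma pressure_outer_ge0 Z a C N : (0 <= pressure_outer f phi Z a C N)%E.
Proof.
apply: le_ereal_inf_tmp => _ [G _ <-]; apply: esum_ge0 => s _.
exact: string_weight_ge0.
Qed.

Lemma pressure_outer_nondecreasing Z a C :
  {homo pressure_outer f phi Z a C : m n / (m <= n)%N >-> (m <= n)%E}.
Proof.
move=> m n mn; apply: ereal_inf_le_tmp => _ [G [GC Gc Gcov Gn] <-].
by exists G => //; split=> // s /Gn; exact: leq_trans.
Qed.

(** The outer sums are nonnegative and nondecreasing in [N], so their limit is their supremum. *)
Lemma pressure_outer_lim_eq0P Z a C : pressure_outer_lim f phi Z a C = 0%E <->
  forall N, pressure_outer f phi Z a C N = 0%E.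
Proof.
rewrite /pressure_outer_lim.
have nd := @pressure_outer_nondecreasing Z a C; split=> [l0 N|h0].
  apply/eqP; rewrite eq_le pressure_outer_ge0 andbT -l0.
  rewrite (cvg_lim _ (ereal_nondecreasing_cvgn nd))//.
  by apply: ereal_sup_ubound; exists N.
have -> : pressure_outer f phi Z a C = cst 0%E by apply/funext.
exact: lim_cst.
Qed.

Definition oscillation_le (C : set (set X)) (e : R) :=
  forall U, C U -> forall x y, U x -> U y -> `|phi x - phi y| <= e.

(** Enlarging the letters of a string of length [m] raises the supremum of the Birkhoff sums by at
    most [e * m], which passing from [a] to [a + e] compensates. *)
Lemma string_weight_refine (C V : set (set X)) (u : set X -> set X) e a s :
  (forall U, V U -> C (u U) /\ U `<=` u U) -> oscillation_le C e ->
  strings V s -> string_set f s !=set0 ->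
  (string_weight f phi (a + e) (map u s) <= string_weight f phi a s)%E.
Proof.
move=> uP Ce Vs [x0 xs]; rewrite lee_expeR size_map.
set S := ereal_sup _; set S' := ereal_sup _.
have SS' : (S - (e * (size s)%:R)%:E <= S')%E.
  rewrite leeBlDr//; apply: ge_ereal_sup => _ [y ys <-].
  apply: (@le_trans _ _ (birkhoff_sum f phi (size s) x0 + e * (size s)%:R)%:E).
    rewrite lee_fin -lerBlDl /birkhoff_sum -sumrB.
    have -> : e * (size s)%:R = \sum_(k < size s) e.
      by rewrite sumr_const card_ord mulr_natr.
    apply: ler_sum => k _.
    have [CU UU] := uP _ (Vs _ (mem_nth set0 (ltn_ord k))).
    have := ys k; rewrite size_map (nth_map set0)// => /(_ (ltn_ord k)) uy.
    have ux := UU _ (xs k (ltn_ord k)).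
    exact: le_trans (ler_norm _) (Ce _ CU _ _ uy ux).
  by rewrite EFinD leeD2r//; apply: ereal_sup_ubound; exists x0.
apply: le_trans (leeD2l _ SS').
by rewrite mulrDl opprD EFinD -addeA leeD2l// addeC EFinN lexx.
Qed.

(** Applying [u] letterwise turns a covering family over [V] into one over [C] with the same
    lengths, and with no larger sum once [a] becomes [a + e]. *)
Lemma pressure_cover_refine (C V : set (set X)) (u : set X -> set X) e :
  (forall U, V U -> C (u U) /\ U `<=` u U) -> oscillation_le C e ->
  (pressure_cover f phi setT C - e%:E <= pressure_cover f phi setT V)%E.
Proof.
move=> uP Ce; apply/ereal_infP => _ [a Va <-]; rewrite /= in Va.
rewrite leeBlDr//; apply: ereal_inf_lbound; exists (a + e) => //=.
move/pressure_outer_lim_eq0P : Va => Va; apply/pressure_outer_lim_eq0P => N.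
apply/eqP; rewrite eq_le pressure_outer_ge0 andbT -(Va N).
apply: le_ereal_inf_tmp => _ [G [GV Gc Gcov GN] <-].
(* Strings followed by no point are dropped: they weigh 0, but their images under [u] may be
   followed by points and have positive weight. *)
pose G' := G `&` [set s | string_set f s !=set0].
apply: (@le_trans _ _ (\esum_(s in map u @` G') string_weight f phi (a + e) s)%E).
  apply: ereal_inf_lbound; exists (map u @` G') => //; split.
  - move=> _ [s [Gs _] <-] U /mapP[W Ws ->].
    by have [] := uP _ (GV _ Gs _ Ws).
  - apply: (sub_countable (card_image_le _ _)); apply: sub_countable Gc.
    by apply: subset_card_le => s [].
  - move=> x _; have [s Gs xs] := Gcov x I.
    exists (map u s); first by exists s => //; split => //; exists x.
    move=> j; rewrite size_map => js; rewrite (nth_map set0)//.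
    by have [_] := uP _ (GV _ Gs _ (mem_nth set0 js)); apply; exact: xs.
  - by move=> _ [s [Gs _] <-]; rewrite size_map; exact: GN.
apply: (@le_trans _ _ (\esum_(s in G') string_weight f phi a s)%E).
  apply: esum_image_le => s [Gs s0].
  exact: (string_weight_refine _ uP Ce (GV _ Gs) s0).
by apply: esum_subset => s [].
Qed.

Lemma small_covers_filter :
  (forall e, 0 < e -> exists2 C, admissible_cover C & (cover_diam d C < e%:E)%E) ->
  ProperFilter (small_covers d).
Proof.
move=> dex; apply: filter_from_proper => [|e e0].
  apply: filter_from_filter => [|e1 e2 e10 e20]; first by exists 1 => /=.
  exists (Num.min e1 e2); first by rewrite /= lt_min e10.
  move=> C [aC]; rewrite EFin_min lt_min => /andP[C1 C2].
  by split; split.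
by have [C aC Ce] := dex _ e0; exists C.
Qed.

(** The limit is the supremum of [pressure_cover C - e] over covers [C] on which [phi] oscillates by
    at most [e]. Fine covers refine any such [C], which gives the lower bound, and belong to the
    family themselves, which gives the upper bound. *)
Lemma pressure_cover_cvg :
  (forall e, 0 < e -> exists2 C, admissible_cover C & (cover_diam d C < e%:E)%E) ->
  (forall C, admissible_cover C -> exists2 e : R, 0 < e & forall V : set X,
    (diam d V < e%:E)%E -> exists2 U, C U & V `<=` U) ->
  (forall e, 0 < e -> \forall C \near small_covers d, oscillation_le C e) ->
  cvg (pressure_cover f phi setT C @[C --> small_covers d]).
Proof.
move=> dex refine osc; have FF := small_covers_filter dex.
pose S : set (\bar R) := [set l | exists C e, [/\ 0 < e, admissible_cover C,
  oscillation_le C e & l = (pressure_cover f phi setT C - e%:E)%E]].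
apply/cvg_ex; exists (ereal_sup S); apply: ereal_cvg_filter.
  move=> x /ereal_sup_gt[_ [C [e [e0 aC Ce ->]]] xCe].
  have [r r0 rC] := refine C aC.
  exists r => // V [aV Vr].
  have /choice[u uP] U : exists W, V U -> C W /\ U `<=` W.
    have [VU|nVU] := pselect (V U); last by exists U.
    have [|W CW UW] := rC U; last by exists W.
    by apply: le_lt_trans Vr; apply: ereal_sup_ubound; exists U.
  exact: le_trans (ltW xCe) (pressure_cover_refine uP Ce).
move=> e e0; have [r r0 Hr] := osc e e0; exists r => // V [aV Vr].
rewrite -leeBlDr//; apply: ereal_sup_ubound; exists V, e; split=> //.
exact: Hr.
Qed.

End pressure_facts.

(** * Partitions are almost uniformly constant *)

Section almost_uniform.
Context (R : realType) (X : pmetricType R) (mu : probability (borel X) R).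
Context (d : X -> X -> R).
Hypothesis dC : forall x y, d x y = d y x.
Hypothesis d_open : forall x e, open [set y | d x y < e].
Hypothesis d_nbhs : forall x (A : set X), nbhs x A ->
  exists2 e : R, 0 < e & [set y | d x y < e] `<=` A.

Lemma open_borel_measurable (A : set X) : open A -> measurable (A : set (borel X)).
Proof. exact: sub_sigma_algebra. Qed.

Lemma measure_small_tail (B : nat -> set (borel X)) (e : R) :
  (forall n, measurable (B n)) -> {homo B : m n / (m <= n)%N >-> n `<=` m} ->
  \bigcap_n B n = set0 -> 0 < e -> exists n, (mu (B n) <= e%:E)%E.
Proof.
move=> mB nB B0 e0.
have : (mu \o B) n @[n --> \oo] --> mu (\bigcap_n B n).
  apply: nonincreasing_cvg_mu => //.
  - by rewrite -ge0_fin_numE// fin_num_measure.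
  - by rewrite B0.
  - by move=> m n mn; apply/subsetPset; exact: nB.
rewrite B0 measure0 => /fine_cvgP[_ /cvgrPdist_le/(_ _ e0)].
case=> n _ /(_ n (leqnn n)); rewrite sub0r normrN /= ger0_norm ?fine_ge0// => h.
by exists n; rewrite -[leLHS]fineK ?lee_fin// fin_num_measure.
Qed.

(* These sets form a sigma-algebra containing the open sets, so neither regularity
   of [mu] nor compactness is needed to separate the atoms of a partition. *)
Definition almost_clopen (A : set (borel X)) := measurable A /\
  forall e : R, 0 < e -> exists (G : set (borel X)) (r : R),
    [/\ measurable G, 0 < r, (mu (~` G) <= e%:E)%E &
        forall x y, G x -> G y -> d x y < r -> A x -> A y].

Lemma almost_clopen0 : almost_clopen set0.
Proof.
split=> // e e0; exists setT, 1; split=> //.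
by rewrite setCT measure0 lee_fin ltW.
Qed.

Lemma almost_clopenC A : almost_clopen A -> almost_clopen (~` A).
Proof.
move=> [mA HA]; split=> [|e e0]; first exact: measurableC.
have [G [r [mG r0 Ge GA]]] := HA e e0; exists G, r; split=> // x y Gx Gy xy nAx Ay.
by apply: nAx; apply: GA Gy Gx _ Ay; rewrite dC.
Qed.

Lemma measure_setCI_le (G H : set (borel X)) e : measurable G -> measurable H ->
  (mu (~` G) <= (e / 2)%:E)%E -> (mu (~` H) <= (e / 2)%:E)%E ->
  (mu (~` (G `&` H)) <= e%:E)%E.
Proof.
move=> mG mH Ge He; rewrite setCI (splitr e) EFinD.
apply: (le_trans (measureU2 _ _ _)); rewrite ?leeD//; exact: measurableC.
Qed.

Lemma almost_clopenU A B : almost_clopen A -> almost_clopen B ->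
  almost_clopen (A `|` B).
Proof.
move=> [mA HA] [mB HB]; split=> [|e e0]; first exact: measurableU.
have e20 : 0 < e / 2 by rewrite divr_gt0.
have [G [r [mG r0 Ge GA]]] := HA _ e20; have [H [s [mH s0 He HH]]] := HB _ e20.
exists (G `&` H), (Num.min r s); split.
- exact: measurableI.
- by rewrite lt_min r0.
- exact: measure_setCI_le.
- move=> x y [Gx Hx] [Gy Hy]; rewrite lt_min => /andP[xr xs] [Ax|Bx].
    by left; exact: GA Ax.
  by right; exact: HH Bx.
Qed.

(** A finite subunion exhausts the union up to measure [e / 2]; off the remainder the two
    coincide. *)
Lemma almost_clopen_bigcup (A : nat -> set (borel X)) :
  (forall n, almost_clopen (A n)) -> almost_clopen (\bigcup_n A n).
Proof.
move=> HA; have mA n : measurable (A n) by have [] := HA n.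
have mUA : measurable (\bigcup_n A n) by exact: bigcup_measurable.
split=> // e e0; pose U n := \big[setU/set0]_(i < n) A i.
have UP n : almost_clopen (U n).
  rewrite /U; elim: n => [|n IHn]; first by rewrite big_ord0; exact: almost_clopen0.
  by rewrite big_ord_recr; exact: almost_clopenU.
have e20 : 0 < e / 2 by rewrite divr_gt0.
have mB n : measurable (\bigcup_n A n `\` U n).
  by apply: measurableD => //; have [] := UP n.
have [n Bn] : exists n, (mu (\bigcup_n A n `\` U n) <= (e / 2)%:E)%E.
  apply: measure_small_tail => //.
    move=> m n mn x [Ax nUx]; split=> //; apply: contra_not nUx.
    rewrite /U -!bigcup_mkord => -[i /= im Aix].
    by exists i => //=; exact: leq_trans im mn.
  rewrite -subset0 => x Bx; have [[n _ Anx] _] := Bx 0%N I.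
  by have [_] := Bx n.+1 I; apply; rewrite /U big_ord_recr; right.
have [mU /(_ _ e20)[G [r [mG r0 Ge GU]]]] := UP n.
exists (G `&` ~` (\bigcup_n A n `\` U n)), r; split=> //.
- by apply: measurableI => //; exact: measurableC.
- by apply: measure_setCI_le; rewrite ?setCK//; exact: measurableC.
- move=> x y [Gx nBx] [Gy _] xy Ax.
  have Ux : U n x by apply: contrapT => nUx; exact: nBx.
  by have := GU _ _ Gx Gy xy Ux; rewrite /U -bigcup_mkord => -[i _ Aiy]; exists i.
Qed.

(** The removed points are those of [A] within [1 / (n + 1)] of its complement; as [A] is open, they
    decrease to the empty set. *)
Lemma almost_clopen_open (A : set X) : open A -> almost_clopen A.
Proof.
move=> oA; have mA := open_borel_measurable oA; split=> // e e0.
pose V n := \bigcup_(y in ~` A) [set x | d y x < n.+1%:R^-1].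
have mV n : measurable (V n : set (borel X)).
  by apply: open_borel_measurable; apply: bigcup_open.
have [n Bn] : exists n, (mu (A `&` V n) <= e%:E)%E.
  apply: measure_small_tail => //.
  - by move=> n; exact: measurableI.
  - move=> m n mn; apply: setIS => x [y nAy /= yx]; exists y => //=.
    by rewrite (lt_le_trans yx)// lef_pV2 ?posrE// ler_nat.
  rewrite -subset0 => x Bx; have [Ax _] := Bx 0%N I.
  have [r r0 rA] := d_nbhs (open_nbhs_nbhs (conj oA Ax)).
  have [n nr] : exists n, n.+1%:R^-1 < r.
    exists (Num.truncn r^-1); rewrite -[ltRHS]invrK ltf_pV2 ?posrE ?invr_gt0//.
    exact: truncnS_gt.
  have [_ [y nAy /= yx]] := Bx n I; apply: nAy; apply: rA => /=.
  by rewrite dC (lt_trans yx).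
exists (~` (A `&` V n)), n.+1%:R^-1; split=> //.
- by apply: measurableC; exact: measurableI.
- by rewrite setCK.
- move=> x y nBx _ xy Ax; apply: contrapT => nAy; apply: nBx; split=> //.
  by exists y => //=; rewrite dC.
Qed.

Lemma measurable_almost_clopen (A : set (borel X)) : measurable A -> almost_clopen A.
Proof.
apply: smallest_sub; last by move=> U; exact: almost_clopen_open.
split; first exact: almost_clopen0.
- by move=> B; rewrite setTD; exact: almost_clopenC.
- exact: almost_clopen_bigcup.
Qed.

Lemma almost_uniformly_constant (k : nat) (nu : borel X -> 'I_k) (e : R) :
  measurable_fibers nu -> 0 < e -> exists (G : set (borel X)) (r : R),
    [/\ measurable G, 0 < r, (mu (~` G) <= e%:E)%E &
        forall x y, G x -> G y -> d x y < r -> nu x = nu y].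
Proof.
move=> mnu e0.
(* Induction over a list of letters, halving the error at each fibre, intersecting the good sets and
   taking the smaller radius. *)
have : forall s : seq 'I_k, forall e : R, 0 < e -> exists (G : set (borel X)) (r : R),
    [/\ measurable G, 0 < r, (mu (~` G) <= e%:E)%E &
        forall x y, G x -> G y -> d x y < r -> nu x \in s -> nu x = nu y].
  elim=> [|i s IHs] {}e {}e0.
    exists setT, 1; split=> //; by rewrite setCT measure0 lee_fin ltW.
  have e20 : 0 < e / 2 by rewrite divr_gt0.
  have [G [r [mG r0 Ge HG]]] := IHs _ e20.
  have [_ /(_ _ e20)[H [t [mH t0 He HH]]]] := measurable_almost_clopen (mnu i).
  exists (G `&` H), (Num.min r t); split.
  - exact: measurableI.
  - by rewrite lt_min r0.
  - exact: measure_setCI_le.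
  - move=> x y [Gx Hx] [Gy Hy]; rewrite lt_min => /andP[xr xt].
    rewrite inE => /predU1P[xi|]; last exact: HG.
    by rewrite xi; apply/esym; exact: HH Hx Hy xt xi.
move=> /(_ (enum 'I_k) e e0)[G [r [mG r0 Ge HG]]]; exists G, r; split=> // x y Gx Gy xy.
by apply: HG => //; rewrite mem_enum.
Qed.

End almost_uniform.

(** * Entropy is bounded by the pressure of a fine cover *)

Section pressure_bound.
Context (R : realType) (X : pmetricType R) (mu : probability (borel X) R).
Context (f : X -> X) (phi : X -> R) (M : R).
Hypothesis fC : continuous f.
Hypothesis fmu : @invariant_measures R X f mu.
Hypothesis phiC : continuous phi.
Hypothesis phiM : forall x, `|phi x| <= M.

Lemma continuous_borel_measurable : measurable_fun setT (f : borel X -> borel X).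
Proof.
apply: (@measurability _ _ (borel X) (borel X) setT f (@open X)) => //.
move=> _ [U oU <-]; rewrite setTI.
by apply: open_borel_measurable; move/continuousP : fC; exact.
Qed.
Let mf := continuous_borel_measurable.

Lemma continuous_real_borel_measurable : measurable_fun setT (phi : borel X -> R).
Proof.
apply: (measurability _ (RGenOpens.measurableE R)) => _ [U [x [y ->]] <-]; rewrite setTI.
apply: open_borel_measurable; move/continuousP : phiC; apply.
exact: interval_open.
Qed.

Lemma string_set_measurable (s : seq (set X)) : (forall U, U \in s -> open U) ->
  measurable (string_set f s : set (borel X)).
Proof.
move=> so; rewrite (_ : string_set f s =
    \bigcap_(j in [set: 'I_(size s)]) (iter j f @^-1` nth set0 s j)).
  apply: fin_bigcap_measurable => // j _.
  apply: (measurable_iter_preimage mf).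
  by apply: open_borel_measurable; apply: so; exact: mem_nth.
apply/seteqP; split=> x xs; first by move=> j _; exact: xs.
by move=> j js; exact: (xs (Ordinal js)).
Qed.

Lemma expR_le_string_weight (a : R) s x : string_set f s x ->
  ((expR (- (a * (size s)%:R) + birkhoff_sum f phi (size s) x))%:E
    <= string_weight f phi a s)%E.
Proof.
move=> xs; rewrite /string_weight.
rewrite -[leLHS]/(expeR (- (a * (size s)%:R) + birkhoff_sum f phi (size s) x)%:E).
rewrite lee_expeR EFinD leeD2l//.
by apply: ereal_sup_ubound; exists x.
Qed.

(** Continuity from above of [mu] along initial segments of an enumeration of [G0]. *)
Lemma finite_subcover_measure (G0 : set (seq (set X))) (e : R) :
  countable G0 -> covers f G0 setT -> 0 < e ->
  (forall s, G0 s -> forall U, U \in s -> open U) ->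
  exists t : seq (seq (set X)), [/\ uniq t, {subset t <= G0} &
    (mu (~` (\bigcup_(s in [set` t]) string_set f s)) <= e%:E)%E].
Proof.
move=> G0c G0cov e0 G0o; have [s0 G0s0 _] := G0cov point I.
have /countable_injP[c cinj] := G0c.
(* [h] enumerates [G0] as a left inverse of [c], with [s0] at the codes that are not attained. *)
have /choice[h hP] n : exists s, G0 s /\ forall s', G0 s' -> c s' = n -> s' = s.
  have [[s [G0s <-]]|ns] := pselect (exists s, G0 s /\ c s = n).
    by exists s; split=> // s' G0s' cs'; apply: cinj; rewrite ?inE.
  by exists s0; split=> // s' G0s' cs'; exfalso; apply: ns; exists s'.
pose t n := undup (map h (iota 0 n)).
have tP n s : s \in t n <-> exists2 i, (i < n)%N & s = h i.
  rewrite mem_undup; split=> [/mapP[i]|[i ni ->]].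
    by rewrite mem_iota => /= ni ->; exists i.
  by apply: map_f; rewrite mem_iota.
have tG0 n : {subset t n <= G0}.
  by move=> s /tP[i _ ->]; rewrite inE; have [] := hP i.
have [n Bn] : exists n, (mu (~` (\bigcup_(s in [set` t n]) string_set f s)) <= e%:E)%E.
  apply: measure_small_tail => // [n|m n mn|].
  - apply: measurableC; apply: fin_bigcup_measurable.
      by apply/finite_seqP; exists (t n).
    move=> s /tG0/set_mem G0s; apply: string_set_measurable; exact: G0o.
  - apply: subsetC => x [s /tP[i im ->] xs]; exists (h i) => //=.
    by apply/tP; exists i => //; exact: leq_trans mn.
  - rewrite -subset0 => x Bx; have [s G0s xs] := G0cov x I.
    apply: (Bx (c s).+1 I); exists s => //=; apply/tP; exists (c s) => //.
    by have [_] := hP (c s); exact.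
by exists (t n); split=> //; exact: undup_uniq.
Qed.

Variables (k : nat) (nu : borel X -> 'I_k).
Hypothesis mnu : measurable_fibers nu.

(* Cost of a blank token, whose weight is 1/2, in excess of [a - phi]. *)
Let K (a : R) := ln 2 + `|a| + M.

(** A correct guess of the letter costs [- ln (1 - del)], any letter at most [- ln (del / k)],
    charged outside [G]. Points missed by the finitely many strings add an error that can be made
    arbitrarily small, since nothing else in the bound depends on that choice. *)
Lemma partition_entropy_le_pressure (C : set (set X)) (a del : R) (G : set (borel X)) :
  0 < del -> del < 1 -> measurable G ->
  (forall U, C U -> open U) ->
  (forall U, C U -> forall x y, U x -> U y -> G x -> G y -> nu x = nu y) ->
  pressure_outer f phi setT a C 1 = 0%E ->
  partition_entropy mu (f : borel X -> borel X) (fun i => nu @^-1` [set i]) <=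
  a - \int[mu]_x phi x - ln (1 - del) - ln (del / k%:R) * fine (mu (~` G)).
Proof.
move=> del0 del1 mG oC CG outer0.
have k0 : 0 < k%:R :> R.
  by rewrite ltr0n; case: (k) (nu point) => // -[].
have mphi := continuous_real_borel_measurable.
have M0 : 0 <= M by exact: le_trans (phiM point).
(* Length at least 1 makes every token nonempty; total weight below 1/2 leaves 1/2 for the blank
   token. *)
have [_ [G0 [G0C G0c G0cov G01] <-] G0w] : exists2 y,
    [set \esum_(s in G0) string_weight f phi a s | G0 in
      [set G0 | [/\ G0 `<=` strings C, countable G0, covers f G0 setT &
                 forall s, G0 s -> (1 <= size s)%N]]] y & (y < (2^-1)%:E)%E.
  by apply: ereal_inf_lt; rewrite -/(pressure_outer _ _ _ _ _ _) outer0 lte_fin.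
(* Within [G] an element of the cover meets at most one fibre of [nu], which is the guess. *)
have /choice[guess guessP] U : exists i, C U -> forall x, U x -> G x -> nu x = i.
  have [[x [Ux Gx]]|nx] := pselect (exists x, U x /\ G x).
    by exists (nu x) => CU y Uy Gy; exact: CG Uy Ux Gy Gx.
  by exists (nu point) => _ x Ux Gx; exfalso; apply: nx; exists x.
pose kap := - ln (del / k%:R).
have kap0 : 0 <= kap.
  rewrite oppr_ge0 ln_le0// ler_pdivrMr// mul1r (le_trans (ltW del1))//.
  by rewrite ler1n -(ltr0n R).
pose lam := - ln (1 - del).
have lam0 : 0 <= lam by rewrite oppr_ge0 ln_le0// gerBl ltW.
pose Ka := K a.
have Ka0 : 0 <= Ka by rewrite !addr_ge0// ln_ge0// ler1n.
apply/ler_addgt0Pr => e e0.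
(* A bad time costs [kap] for its letter and [Ka] for a blank token; the [+ 1] keeps the denominator
   positive. *)
have bade : 0 < e / (kap + Ka + 1).
  by rewrite divr_gt0// ltr_wpDl// addr_ge0.
have [t [tuniq tG0 tbad]] := finite_subcover_measure G0c G0cov bade
  (fun s G0s U Us => oC U (G0C s G0s U Us)).
set cov := \bigcup_(s in [set` t]) _ in tbad.
pose bad : set (borel X) := ~` cov.
have mcov : measurable (cov : set (borel X)).
  apply: fin_bigcup_measurable; first by apply/finite_seqP; exists t.
  move=> s /tG0/set_mem G0s; apply: string_set_measurable => U Us.
  exact: oC (G0C _ G0s _ Us).
have mbad : measurable bad by exact: measurableC.
(* [None] is the blank token, of length 1 and with an arbitrary prediction. *)
pose w (j : option (seq (set X))) : R :=
  if j is Some s then fine (string_weight f phi a s) else 2^-1.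
pose word (j : option (seq (set X))) : seq 'I_k :=
  if j is Some s then map guess s else [:: nu point].
(* Mixture of the point mass at the guess with the uniform law, so that every letter keeps positive
   probability. *)
pose r (g x : 'I_k) : R := (1 - del) * (x == g)%:R + del / k%:R.
pose F := None :: map some t.
have tw : (\sum_(s <- t) string_weight f phi a s <= (2^-1)%:E)%E.
  apply: le_trans (ltW G0w); rewrite fsbig_seq//; apply: esum_ge.
  exists [set` t] => //; split; first by apply/finite_seqP; exists t.
  by move=> s /tG0/set_mem.
have wfin s : s \in t -> string_weight f phi a s \is a fin_num.
  move=> st; rewrite ge0_fin_numE ?string_weight_ge0//.
  apply: le_lt_trans (ltry 2^-1); apply: le_trans tw.
  by rewrite (big_rem s)//= leeDl// sume_ge0// => i _; exact: string_weight_ge0.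
have w0 j : 0 <= w j.
  by case: j => [s|] /=; rewrite ?fine_ge0 ?string_weight_ge0.
have w1 : \sum_(j <- F) w j <= 1.
  rewrite big_cons big_map /= [leRHS](splitr 1) div1r lerD2l.
  rewrite -lee_fin -sumEFin; apply: le_trans tw; rewrite le_eqVlt; apply/orP; left.
  by apply/eqP; apply: eq_big_seq => s /wfin; exact: fineK.
have r0 g x : 0 <= r g x.
  by rewrite addr_ge0 ?mulr_ge0 ?divr_ge0 ?subr_ge0 ?ler0n// ltW.
have r1 g : \sum_x r g x <= 1.
  rewrite big_split /= -mulr_sumr sumr_const card_ord (bigD1 g)//= eqxx.
  rewrite big1 => [|i /negbTE -> //].
  by rewrite addr0 mulr1 -[_ *+ k]mulr_natr divfK ?gt_eqF// subrK.
pose ee x : R := lam + kap * \1_(~` G) x + kap * \1_bad x.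
pose v x : R := a - phi x + Ka * \1_bad x.
(* A bound for all token lengths; the successor covers the blank token even if [t] is empty. *)
pose L := (\sum_(s <- t) size s).+1.
pose V := `|a| + M + Ka.
have V0 : 0 <= V by apply: addr_ge0 => //; apply: addr_ge0.
have indic_bd (A : set (borel X)) (x : borel X) : 0 <= (\1_A x : R) <= 1.
  by rewrite indicE; case: (_ \in _); rewrite /= ?lexx ?ler01.
have indic0 (A : set (borel X)) (x : borel X) : 0 <= (\1_A x : R).
  by have /andP[] := indic_bd A x.
have vV x : `|v x| <= V.
  have /andP[b0 b1] := indic_bd bad x.
  rewrite (le_trans (ler_normD _ _))// lerD// ?(le_trans (ler_normB _ _)) ?lerD2l//.
  by rewrite normrM !ger0_norm// ler_piMr.
have eeE x : `|ee x| <= lam + kap + kap.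
  have /andP[b0 b1] := indic_bd bad x; have /andP[g0 g1] := indic_bd (~` G) x.
  rewrite ger0_norm ?addr_ge0 ?mulr_ge0//.
  by rewrite !lerD// ler_piMr.
have r_kap g x : expR (- kap) <= r g x.
  rewrite opprK lnK ?posrE ?divr_gt0// lerDr mulr_ge0// subr_ge0 ltW//.
have r_lam g x : x = g -> expR (- lam) <= r g x.
  move=> ->; rewrite opprK lnK ?posrE ?subr_gt0// /r eqxx mulr1 lerDl.
  by rewrite divr_ge0// ltW.
have choose x : exists2 j, j \in F &
  [/\ word j != [::], (size (word j) <= L)%N, follows r f nu ee (word j) x &
      expR (- \sum_(i < size (word j)) v (iter i f x)) <= w j].
  have [[s st xs]|nx] := pselect (cov x).
    have G0s := set_mem (tG0 _ st).
    exists (Some s).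
      by rewrite inE map_f ?orbT.
    split=> /=.
    - by rewrite -size_eq0 size_map -lt0n G01.
    - by rewrite size_map /L (big_rem s)//= -addnS leq_addr.
    - move=> i g; rewrite size_map => si; rewrite (nth_map set0)//.
      have Us := mem_nth set0 si; have CU := G0C _ G0s _ Us.
      have [Gi|nGi] := pselect (G (iter i f x)).
        rewrite (le_trans _ (r_lam _ _ (guessP _ CU _ (xs i si) Gi)))//.
        rewrite ler_expR lerN2 /ee -addrA lerDl.
        by rewrite addr_ge0// mulr_ge0.
      have gx : \1_(~` G) (iter i f x : borel X) = 1 :> R by rewrite indicE mem_set.
      rewrite (le_trans _ (r_kap _ _))// ler_expR lerN2 /ee gx mulr1.
      by rewrite addrAC lerDr addr_ge0// mulr_ge0.
    - rewrite size_map -lee_fin fineK ?wfin//.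
      apply: le_trans (expR_le_string_weight a xs).
      rewrite lee_fin ler_expR /birkhoff_sum.
      have -> : a * (size s)%:R = \sum_(i < size s) a.
        by rewrite sumr_const card_ord mulr_natr.
      rewrite addrC -opprB -sumrB lerN2; apply: ler_sum => i _.
      by rewrite /v lerDl mulr_ge0.
  have bx : \1_bad x = 1 :> R by rewrite indicE mem_set.
  exists None; first by rewrite inE.
  split=> //=.
  - move=> [|//] g _ /=; rewrite (le_trans _ (r_kap _ _))// ler_expR lerN2.
    by rewrite /ee bx mulr1 lerDr addr_ge0// mulr_ge0.
  - rewrite big_ord_recl big_ord0 addr0 /= -[leRHS]lnK ?posrE ?invr_gt0//.
    rewrite ler_expR lnV ?posrE// lerN2 /v bx mulr1 /Ka /K.
    have := phiM x; rewrite ler_norml => /andP[_ p2].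
    have := ler_norm (- a); rewrite normrN; lra.
have vB x n : (n <= L)%N -> \sum_(i < n) v (iter i f x) <= L%:R * V.
  move=> nL; apply: (@le_trans _ _ (\sum_(i < n) V)).
    by apply: ler_sum => i _; exact: le_trans (ler_norm _) (vV _).
  rewrite sumr_const card_ord -[_ *+ n]mulr_natl ler_wpM2r ?ler_nat//.
pose g n x := \sum_(j < n) (ee (iter j f x) + v (iter j f x)) + L%:R * V.
have mev : measurable_fun setT (fun x : borel X => ee x + v x).
  apply: measurable_funD; last first.
    apply: measurable_funD; first exact: measurable_funB.
    by apply: measurable_funM => //; exact: measurable_indic.
  apply: measurable_funD; last first.
    by apply: measurable_funM => //; exact: measurable_indic.
  apply: measurable_funD => //.
  by apply: measurable_funM => //; apply: measurable_indic; exact: measurableC.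
have evM x : `|ee x + v x| <= lam + kap + kap + V.
  by rewrite (le_trans (ler_normD _ _))// lerD.
have mevi j : measurable_fun setT (fun x : borel X => ee (iter j f x) + v (iter j f x)).
  exact: (measurableT_comp mev (measurable_iter mf j)).
have iev j : mu.-integrable setT (EFin \o (fun x => ee (iter j f x) + v (iter j f x))).
  by apply: (bounded_integrable mu (mevi j)) => x; exact: evM.
have sumM n x : `|\sum_(j < n) (ee (iter j f x) + v (iter j f x))| <=
    n%:R * (lam + kap + kap + V).
  rewrite (le_trans (ler_norm_sum _ _ _))//.
  apply: (@le_trans _ _ (\sum_(i < n) (lam + kap + kap + V))).
    by apply: ler_sum => i _; exact: evM.
  by rewrite sumr_const card_ord mulr_natl.
(* By invariance all [n] terms of the sum have the same integral, so the bound is linear in [n]. *)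
have H n : join_entropy mu (f : borel X -> borel X) (fun i => nu @^-1` [set i]) n <=
    n%:R * (\int[mu]_x (ee x + v x)) + L%:R * V.
  apply: (le_trans (@join_entropy_le_Rintegral _ _ _ _ _ mf _ _ mnu n
    (fun s => code_weight F w word r [::] [seq s i | i <- enum 'I_n]) (g n)
    (n%:R * (lam + kap + kap + V) + L%:R * V) _ _ _ _ _)).
  - by move=> s; exact: code_weight_ge0.
  - exact: sum_code_weight_le1.
  - by apply: measurable_funD => //; exact: measurable_sum.
  - move=> x; rewrite (le_trans (ler_normD _ _))// lerD//.
    by rewrite ger0_norm// mulr_ge0.
  - move=> x.
    have := code_weight_ge w0 r0 choose vB n (t := [::]) (x := x) isT.
    rewrite big_ord0 subr0 => /(_ _); rewrite /g.
    rewrite (_ : [seq itinerary (f : borel X -> borel X) nu n x i | i <- enum 'I_n] =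
      [seq nu (iter j f x) | j <- iota 0 n]); first by apply.
    rewrite -val_enum_ord -map_comp; apply: eq_map => i /=.
    by rewrite ffunE.
  rewrite /g [leLHS]RintegralD//; last 2 first.
  - apply: (@bounded_integrable _ _ _ _ _ (n%:R * (lam + kap + kap + V))) => [|x].
      exact: measurable_sum.
    exact: sumM.
  - exact: (@bounded_integrable _ _ _ _ (cst (L%:R * V)) `|L%:R * V|).
  rewrite Rintegral_const lerD2r Rintegral_sum//.
  rewrite (eq_bigr (fun=> \int[mu]_x (ee x + v x))) => [|j _].
    by rewrite sumr_const card_ord mulr_natl.
  exact: (Rintegral_iter mf fmu _ mev evM).
apply: (le_trans (partition_entropy_le mf fmu mnu H)).
have -> : (fun x => ee x + v x) = (fun x : borel X =>
    (lam + a) + kap * \1_(~` G) x + (kap + Ka) * \1_bad x - phi x).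
  by apply/funext => x; rewrite /ee /v; lra.
have iG := indic_integrable mu kap (measurableC mG).
have ib := indic_integrable mu (kap + Ka) mbad.
have iphi : mu.-integrable setT (EFin \o phi) by exact: bounded_integrable mphi phiM.
have ic : mu.-integrable setT (EFin \o cst (lam + a)).
  by apply: (@bounded_integrable _ _ _ _ _ `|lam + a|).
have iD (g1 g2 : borel X -> R) : mu.-integrable setT (EFin \o g1) ->
    mu.-integrable setT (EFin \o g2) ->
    mu.-integrable setT (EFin \o (fun x => g1 x + g2 x)).
  by move=> i1 i2; have := integrableD measurableT i1 i2.
rewrite RintegralB//; last by apply: (iD) => //; exact: iD.
rewrite RintegralD//; last exact: iD.
rewrite RintegralD// Rintegral_const !Rintegral_indic//; last exact: measurableC.
have badle : fine (mu bad) <= e / (kap + Ka + 1).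
  rewrite -lee_fin fineK//; exact: fin_num_measure.
have : (kap + Ka) * fine (mu bad) <= e.
  have kK : 0 < kap + Ka + 1 by rewrite ltr_wpDl// addr_ge0.
  apply: (@le_trans _ _ ((kap + Ka + 1) * (e / (kap + Ka + 1)))).
    apply: ler_pM => //; [exact: addr_ge0|exact: fine_ge0|by rewrite lerDl].
  by rewrite mulrC divfK// gt_eqF.
rewrite /lam /kap; lra.
Qed.

End pressure_bound.

(** * From fine covers to the limit and the supremum over invariant measures *)

Lemma partition_fibers (d : measure_display) (T : measurableType d) (k : nat)
    (A : 'I_k -> set T) :
  (forall i, measurable (A i)) -> partition [set: 'I_k] A [set: T] ->
  exists2 nu : T -> 'I_k, measurable_fibers nu &
    A = (fun i => nu @^-1` [set i]).
Proof.
move=> mA [covA /trivIsetP triv _].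
have /choice[nu nuP] x : exists i, A i x.
  have [i _ Ai] : cover [set: 'I_k] A x by rewrite covA.
  by exists i.
have AE : A = (fun i => nu @^-1` [set i]).
  apply/funext => i; apply/seteqP; split=> [x Ax /=|x /= <-]; last exact: nuP.
  apply: contrapT => /eqP nxi.
  have : (A (nu x) `&` A i) x by split => //; exact: nuP.
  by rewrite (triv _ _ I I nxi).
by exists nu => // i; rewrite -[X in measurable X]/((fun i => nu @^-1` [set i]) i) -AE.
Qed.

Theorem theorem4p1 (R : realType) (X : pmetricType R)
  (lcX : locally_compact [set: X]) (sepX : separable X)
  (dt : one_point_compactification X -> one_point_compactification X -> R)
  (dtP : metrizes dt)
  (f : X -> X) (fP : proper_map f)
  (phi : X -> R) (phiC : continuous phi)
  (phit : one_point_compactification X -> R) (phitC : continuous phit)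
  (phitE : forall x : X, phit (Some x) = phi x)
  (Mf : @invariant_measures R X f !=set0) :
  (ereal_sup [set measure_entropy mu (f : borel X -> borel X)
                  + \int[mu]_(x in [set: borel X]) (phi x)%:E
             | mu in @invariant_measures R X f]
   <= pressure (fun x y : X => dt (Some x) (Some y)) f phi [set: X])%E.
Proof.
have cptX := @one_point_compactification_compact X.
have [fC _] := fP.
pose d x y := dt (Some x) (Some y).
have dC x y : d x y = d y x by case: (dtP) => _ dC _ _; exact: dC.
have d_open x e : open [set y | d x y < e] by exact: one_point_dist_open.
have d_nbhs (x : X) (A : set X) : nbhs x A ->
    exists2 e : R, 0 < e & [set y | d x y < e] `<=` A.
  move=> /one_point_compactification_some_nbhs; case: (dtP) => _ _ _ ->.
  move=> [e /= e0 eA]; exists e => // y /eA[z Az [<-]]; exact: Az.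
have [M phiM] : exists M, forall x, `|phi x| <= M.
  have : compact (phit @` setT).
    by apply: continuous_compact => //; exact: continuous_subspaceT.
  move=> /compact_bounded[N [_ /(_ (N + 1))]]; rewrite ltrDl => /(_ ltr01) NM.
  by exists (N + 1) => x; rewrite -phitE; apply: NM; exists (Some x).
have dex e : 0 < e -> exists2 C : set (set X), admissible_cover C &
    (cover_diam d C < e%:E)%E by exact: small_covers_ex.
have FF := small_covers_filter dex.
have osc e : 0 < e -> \forall C \near small_covers d, oscillation_le phi C e.
  move=> e0; have [r r0 Hr] := metrizes_unif_continuous dtP cptX phitC e0.
  exists r => // C [_ Cr] U CU x y Ux Uy; rewrite -!phitE; apply/ltW/Hr.
  exact: cover_diam_lt Cr CU Ux Uy.
(* Convergence lets a lower bound valid for all fine covers pass to the [lim] that defines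
   [pressure]. *)
have cvgP := pressure_cover_cvg (f := f) dex (admissible_cover_refine dtP) osc.
apply: ge_ereal_sup => _ [mu fmu <-].
have mphi := continuous_real_borel_measurable phiC.
have iphi : mu.-integrable setT (EFin \o phi) by exact: (bounded_integrable mu mphi phiM).
(* The integral is finite, so it can be moved across the inequality even when entropy or pressure is
   infinite. *)
rewrite -[X in (_ + X)%E]fineK; last exact: integrable_fin_num.
rewrite -/(Rintegral mu setT phi); set c := Rintegral _ _ _.
rewrite -leeBrDr//; apply: ge_ereal_sup => _ [k [A [mA partA ->]]].
have [nu mnu ->] := partition_fibers mA partA.
set h := partition_entropy _ _ _.
rewrite leeBrDr// -EFinD; apply/lee_addgt0Pr => e e0.
rewrite -leeBlDr// -EFinB; apply: lime_ge => //.
(* Chosen so that [- ln (1 - del)] is [e / 2]; the other [e / 2] pays for the letters read outside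
   [G]. *)
pose del := 1 - expR (- (e / 2)).
have e20 : 0 < e / 2 by rewrite divr_gt0.
have del1 : del < 1 by rewrite gtrBl expR_gt0.
have del0 : 0 < del by rewrite subr_gt0 expR_lt1 oppr_lt0.
have lnE : ln (1 - del) = - (e / 2) by rewrite /del opprB addrC subrK expRK.
have k1 : 1 <= k%:R :> R by rewrite ler1n; case: (k) (nu point) => // -[] //.
have kap0 : 0 < - ln (del / k%:R).
  have k0 : 0 < k%:R :> R by exact: lt_le_trans k1.
  by rewrite oppr_gt0 ln_lt0// divr_gt0//= ltr_pdivrMr// mul1r (lt_le_trans del1).
have [G [r [mG r0 Ge HG]]] := almost_uniformly_constant mu dC d_open d_nbhs mnu
  (divr_gt0 e20 kap0).
exists r => // C [[finC admC covC] Cr].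
apply/ereal_infP => _ [a Ca <-]; rewrite lee_fin.
have outer0 := (pressure_outer_lim_eq0P f phi setT a C).1 Ca 1%N.
have := partition_entropy_le_pressure fC fmu phiC phiM mnu del0 del1 mG
  (fun U CU => (admC U CU).1)
  (fun U CU x y Ux Uy Gx Gy => HG x y Gx Gy (cover_diam_lt Cr CU Ux Uy)) outer0.
have : - ln (del / k%:R) * fine (mu (~` G)) <= e / 2.
  rewrite mulrC -ler_pdivlMr// -lee_fin fineK//; apply: fin_num_measure.
  exact: measurableC.
rewrite lnE -/h -/c; lra.
Qed.
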